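(* There is a wRK-complete proper uncountable $\mathbf{\Pi}^1_1$ ideal on $\omega$; that is, there is a proper uncountable $\mathbf{\Pi}^1_1$ ideal $\mathcal J$ on $\omega$ such that $\mathcal I \leq_{\rm wRK} \mathcal J$ for every proper uncountable $\mathbf{\Pi}^1_1$ ideal $\mathcal I$ on $\omega$.
   Context: The power set $\mathcal P(\omega)$ is identified with the Cantor space $2^\omega$ via characteristic functions. An ideal on $\omega$ is a family $\mathcal I$ of subsets of $\omega$ such that for all $x,y\subseteq\omega$: $x,y\in\mathcal I \implies x\cup y\in\mathcal I$, and $y\subseteq x\in\mathcal I \implies y\in\mathcal I$. An ideal $\mathcal I$ is proper if $\mathcal I\neq 2^\omega$ and $\mathcal I$ contains all finite subsets of $\omega$. An ideal is called $\mathbf{\Pi}^1_1$ if it is a (boldface) $\mathbf{\Pi}^1_1$, i.e. co-analytic, subset of $2^\omega$, and uncountable if it is uncountable as a subset of $2^\omega$. For ideals $\mathcal I,\mathcal J$ on $\omega$, $\mathcal I\leq_{\rm wRK}\mathcal J$ (weak Rudin-Keisler reducibility) means that there are an infinite set $A\subseteq\omega$ and a function $f:A\to\omega$ such that for each $x\subseteq\omega$, $x\in\mathcal I \iff f^{-1}[x]\in\mathcal J$, where $f^{-1}[x]=\{a\in A: f(a)\in x\}$. If $\mathcal C$ is a family of ideals and $\mathcal J\in\mathcal C$ satisfies $\mathcal I\leq_{\rm wRK}\mathcal J$ for each $\mathcal I\in\mathcal C$, then $\mathcal J$ is called a wRK-complete $\mathcal C$ ideal. *)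

(* Defs.v *)
From HB Require Import structures.
From mathcomp Require Import all_boot all_order all_algebra.
From mathcomp Require Import boolp classical_sets functions cardinality.
From mathcomp Require Import reals topology cantor.

Set Implicit Arguments.
Unset Strict Implicit.
Unset Printing Implicit Defensive.

Local Open Scope classical_set_scope.

Definition baire_space : Type := prod_topology (fun _ : nat => nat).

HB.instance Definition _ := Pointed.on baire_space.
HB.instance Definition _ := Nbhs.on baire_space.
HB.instance Definition _ := Topological.on baire_space.
HB.instance Definition _ := Uniform.on baire_space.

(* The boldface classes: Sigma^1_1 sets are the projections of the closed
   subsets of T * baire_space, and Pi^1_1 sets are their complements. These are
   the usual classes when T is a Polish space; only T = cantor_space is used. *)
Definition Sigma11 (T : topologicalType) (A : set T) : Prop :=
  exists2 F : set (T * baire_space), closed F & A = fst @` F.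

Definition Pi11 (T : topologicalType) (A : set T) : Prop := Sigma11 (~` A).

(* The identification of the power set of nat with the Cantor space: x is the
   characteristic function of [set n | x n]. *)
Definition char_family (I : set (set nat)) : set cantor_space :=
  [set x : cantor_space | I [set n | x n]].

Definition ideal (I : set (set nat)) : Prop :=
  (forall x y, I x -> I y -> I (x `|` y)) /\
  (forall x y, y `<=` x -> I x -> I y).

Definition proper_ideal (I : set (set nat)) : Prop :=
  [/\ ideal I, I <> setT & forall x, finite_set x -> I x].

Definition proper_uncountable_Pi11_ideal (I : set (set nat)) : Prop :=
  [/\ proper_ideal I, ~ countable (char_family I) & Pi11 (char_family I)].

(* A function A -> nat is represented by a total f, of which only the values
   on A matter. *)
Definition wRK_le (I J : set (set nat)) : Prop :=
  exists A : set nat, infinite_set A /\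
    exists f : nat -> nat, forall x : set nat, I x <-> J (A `&` f @^-1` x).

Definition wRK_complete (C : set (set (set nat))) (J : set (set nat)) : Prop :=
  C J /\ forall I, C I -> wRK_le I J.

(* Main.v *)
Require Import Defs.
From mathcomp Require Import all_boot classical_sets.
From mathcomp Require Import mathcomp_extra boolp functions cardinality.
From mathcomp Require Import topology cantor.

(** A tree-valued map [T] presents the Pi^1_1 set of the [x] with [T x] well
    founded. For every [T], the union of the initial segments
    [{y | rank (T y) <= a}] that are, together with all smaller ones, closed under
    subsets modulo finite of binary unions is again Pi^1_1, because ranks are
    compared by maps between trees; it is empty or an ideal containing the finite
    sets. So every code [c] of such a [T] yields an ideal, and every Pi^1_1 ideal
    arises: if [R] presents it, let [T 0 = R], let [T n.+1 y] be the tree of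
    attempts to build [y'] of rank at most that of [y], some [w] contained in
    [y `|` y'] modulo a finite set, and a branch of [T n w], and join the
    [T n y] below a common root. The universal ideal lives on finite sequences:
    it requires that the trace on each branch [c] be finite or belong to the
    ideal coded by [c]. *)

Set Implicit Arguments.
Unset Strict Implicit.
Unset Printing Implicit Defensive.
Local Open Scope classical_set_scope.

(** * Comparison of trees *)

Definition tree (A : set (seq nat)) : Prop :=
  A [::] /\ forall s k, A s -> A (take k s).

Definition illfounded (A : set (seq nat)) : Prop :=
  exists b : nat -> nat, forall k, A (mkseq b k).

Definition lipschitz (e : seq nat -> seq nat) : Prop :=
  (forall s, size (e s) = size s) /\ forall s k, e (take k s) = take k (e s).

(** For trees this is the comparison of ranks, an ill-founded tree having the largest rank;
    [tree_lt] then puts every tree below an ill-founded one, including itself. *)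
Definition tree_le (A B : set (seq nat)) : Prop :=
  exists2 e, lipschitz e & forall s, A s -> B (e s).

Definition tree_lt (A B : set (seq nat)) : Prop :=
  exists m, tree_le A [set s | B (m :: s)].

Lemma take_mkseq (T : Type) (b : nat -> T) k n :
  take k (mkseq b n) = mkseq b (minn k n).
Proof.
rewrite /mkseq -map_take; congr map.
case: (leqP k n) => h; first by rewrite take_iota (minn_idPl h).
by rewrite take_oversize // size_iota ltnW.
Qed.

Lemma tree_le_refl A : tree_le A A.
Proof. by exists id. Qed.

Lemma tree_le_trans B A C : tree_le A B -> tree_le B C -> tree_le A C.
Proof.
move=> [e [se te] eAB] [f [sf tf] fBC]; exists (f \o e) => /=.
  by split=> [s|s k] /=; rewrite ?sf ?se ?te ?tf.
by move=> s /eAB /fBC.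
Qed.

Lemma tree_ltW A B : tree B -> tree_lt A B -> tree_le A B.
Proof.
move=> [_ tB] [m [e [se te] eAB]].
(* Prepending [m] makes the image one entry too long; its truncation stays in [B], a tree. *)
exists (fun s => take (size s) (m :: e s)).
  split=> [s|s k]; first by rewrite size_take /= se ltnS leqnn.
  rewrite te size_take_min -take_min; case E: (minn k (size s)) => [|j] //=.
  by rewrite take_takel // ltnW // -E geq_minl.
by move=> s /eAB /tB; apply.
Qed.

Lemma lipschitz_branch e b : lipschitz e ->
  forall k, mkseq (fun n => nth 0 (e (mkseq b n.+1)) n) k = e (mkseq b k).
Proof.
move=> [se te] k; apply: (@eq_from_nth _ 0); rewrite !size_mkseq ?se ?size_mkseq //.
move=> i ik; rewrite nth_mkseq // -(minn_idPl ik) -take_mkseq te nth_take //.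
Qed.

Lemma illfounded_le A B : tree_le A B -> illfounded A -> illfounded B.
Proof.
move=> [e le eAB] [b bA]; exists (fun n => nth 0 (e (mkseq b n.+1)) n) => k.
by rewrite lipschitz_branch //; apply: eAB.
Qed.

Lemma illfounded_lt A B : illfounded B -> tree_lt A B.
Proof.
move=> [b bB]; exists (b 0); exists (fun s => mkseq (b \o S) (size s)) => [|s _].
  split=> [s|s k]; first by rewrite size_mkseq.
  by rewrite take_mkseq size_take_min.
by have := bB (size s).+1; rewrite /mkseq /= (iotaDl 1 0) -map_comp.
Qed.

(** Iterating [m :: e s] from the empty sequence gives nested nodes of [A] of every length, hence a
    branch. *)
Lemma tree_lt_irrefl A : tree A -> tree_lt A A -> illfounded A.
Proof.
move=> [A0 tA] [m [e [se te] eA]].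
pose f s := m :: e s; pose a k := iter k f [::].
have sa k : size (a k) = k by elim: k => //= k IH; rewrite se IH.
have Aa k : A (a k) by elim: k => //= k IH; apply: eA.
have pa k : take k (a k.+1) = a k.
  elim: k => [|k IH]; first by rewrite take0.
  by rewrite -[a k.+2]/(m :: e (a k.+1)) /= -te IH.
exists (fun n => nth 0 (a n.+1) n) => k.
suff -> : mkseq (fun n => nth 0 (a n.+1) n) k = a k by [].
elim: k => // k IH; rewrite mkseqS IH -[RHS](cat_take_drop k) pa -cats1.
congr (_ ++ _).
by rewrite (drop_nth 0) ?sa // drop_oversize // sa.
Qed.

(** [Z] lists the safe positions of a game in which one player climbs [A] and the other answers in
    [B]. Answers fixed by a choice function depend only on the moves made so far, so they form a
    Lipschitz map. *)
Lemma tree_le_of_simulation A B (Z : seq nat -> seq nat -> Prop) : tree A ->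
  Z [::] [::] ->
  (forall s t n, Z s t -> A (rcons s n) -> exists m, Z (rcons s n) (rcons t m)) ->
  (forall s t, Z s t -> B t) -> tree_le A B.
Proof.
move=> [_ tA] Z0 ZS ZB.
have /choice[next nextP] (p : seq nat * seq nat * nat) : exists m,
    Z p.1.1 p.1.2 -> A (rcons p.1.1 p.2) -> Z (rcons p.1.1 p.2) (rcons p.1.2 m).
  have [[Zp Ap]|h] := pselect (Z p.1.1 p.1.2 /\ A (rcons p.1.1 p.2)).
    by have [m Zm] := ZS _ _ _ Zp Ap; exists m.
  by exists 0 => Zp Ap; case: h.
(* Moves are added at the end, so the recursion runs through the reversed sequence. *)
pose E := fix E r := if r is n :: r' then
  rcons (E r') (next (rev r', E r', n)) else [::].
pose e s := E (rev s).
have eS s n : e (rcons s n) = rcons (e s) (next (s, e s, n)).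
  by rewrite /e rev_rcons /= revK.
have se s : size (e s) = size s.
  by elim/last_ind: s => // s n IH; rewrite eS !size_rcons IH.
exists e.
  split=> // s k; elim/last_ind: s => // s n IH; rewrite eS.
  have [ks|sk] := leqP k (size s); first by rewrite -!cats1 !takel_cat ?se.
  by rewrite !take_oversize ?eS // size_rcons ?se.
move=> s As; apply: (ZB s); elim/last_ind: s As => // s n IH As.
rewrite eS; apply: (nextP (s, e s, n)) => //=; apply: IH.
by have := tA _ (size s) As; rewrite -cats1 take_size_cat.
Qed.

Lemma tree_le_children A B : tree A -> B [::] ->
  (forall n, A [:: n] ->
    exists m, tree_le [set s | A (n :: s)] [set s | B (m :: s)]) ->
  tree_le A B.
Proof.
move=> [_ tA] B0 h.
have /choice[f fP] n : exists p : nat * (seq nat -> seq nat), lipschitz p.2 /\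
    (A [:: n] -> forall s, A (n :: s) -> B (p.1 :: p.2 s)).
  have [/h[m [e le eAB]]|nA] := pselect (A [:: n]); first by exists (m, e).
  by exists (0, id).
exists (fun s => if s is n :: s' then (f n).1 :: (f n).2 s' else [::]).
  split=> [[|n s]|[|n s] [|k]] //=; have [[se te] _] := fP n; by rewrite ?se ?te.
case=> // n s As; apply: (fP n).2 => //.
by have := tA _ 1 As; rewrite /= take0.
Qed.

(** If [A] does not map to [B], some child [n] of the root of [A] is dominated by no child of the
    root of [B]. Each move in [B] can be answered in [A] so that this failure persists, which
    simulates [B] above [n]. *)
Lemma tree_le_or_lt A B : tree A -> tree B -> tree_le A B \/ tree_lt B A.
Proof.
move=> TA TB; pose sub C s := [set u : seq nat | C (s ++ u)].
have subT C s : tree C -> C s -> tree (sub C s).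
  move=> [C0 tC] Cs; split=> [|u k]; rewrite /sub /= ?cats0 // => Csu.
  by have := tC _ (size s + k) Csu; rewrite take_cat ltnNge leq_addr /= addKn.
(* The position [(s, t)] is lost when no child of [t] in [B] dominates [s] in [A]. *)
pose lost s t := A s /\
  forall m, ~ (B (rcons t m) /\ tree_le (sub A s) (sub B (rcons t m))).
have losing s t : A s -> B t -> ~ tree_le (sub A s) (sub B t) ->
    exists n, lost (rcons s n) t.
  move=> As Bt; apply: contra_notP => /forallNP h.
  apply: tree_le_children; [exact: subT|by rewrite /sub /= cats0|].
  move=> n; rewrite /sub /= cats1 => Asn.
  have := h n; rewrite /lost => /not_andP[//|/existsNP[m /contrapT[_ le]]].
  exists m; move: le; rewrite /sub.
  under eq_set do rewrite cat_rcons.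
  by under [X in tree_le _ X]eq_set do rewrite cat_rcons.
have [|nAB] := pselect (tree_le A B); [by left|right].
have [n lostn] : exists n, lost [:: n] [::].
  exact: (losing [::] [::] TA.1 TB.1).
exists n; apply: (@tree_le_of_simulation _ _ (fun t s => B t /\ lost (n :: s) t)) => //.
- by split=> //; apply: TB.1.
- move=> t s m [Bt [As lst]] Bm.
  have [|n' ln'] := losing (n :: s) (rcons t m) As Bm.
    by move=> le; apply: (lst m).
  by exists n'.
- by move=> t s [_ []].
Qed.

(** * Closed subsets of the product of the Cantor and Baire spaces *)

Definition cantor_baire : Type := ((nat -> bool) * (nat -> nat))%type.

Definition agree N (p q : cantor_baire) : Prop :=
  forall k, k < N -> p.1 k = q.1 k /\ p.2 k = q.2 k.

Definition locally_constant V (f : cantor_baire -> V) : Prop :=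
  forall p, exists N, forall q, agree N p q -> f q = f p.

(* By [seq_closedP] these are the closed subsets of [cantor_space * baire_space]. *)
Definition seq_closed (F : set cantor_baire) : Prop :=
  forall p, ~ F p -> exists N, forall q, agree N p q -> ~ F q.

Lemma agree_le N M p q : N <= M -> agree M p q -> agree N p q.
Proof. by move=> NM h k kN; apply: h; apply: leq_trans NM. Qed.

Lemma lc_cst V (v : V) : locally_constant (fun=> v).
Proof. by exists 0. Qed.

(** Near [p] the value [f p] is frozen, so only [F (f p)] varies. This allows a coordinate to be
    read at an index computed from the point. *)
Lemma lc_bind V W (f : cantor_baire -> V) (F : V -> cantor_baire -> W) :
  locally_constant f -> (forall v, locally_constant (F v)) ->
  locally_constant (fun p => F (f p) p).
Proof.
move=> cf cF p; have [N fN] := cf p; have [M FM] := cF (f p) p.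
exists (maxn N M) => q pq.
rewrite fN ?FM //; first exact: agree_le (leq_maxr _ _) pq.
exact: agree_le (leq_maxl _ _) pq.
Qed.

Lemma lc_comp V W (g : V -> W) f :
  locally_constant f -> locally_constant (fun p => g (f p)).
Proof.
by move=> cf; apply: (@lc_bind V W f (fun v _ => g v)) => // v; apply: lc_cst.
Qed.

Lemma lc_comp2 V W U (g : V -> W -> U) f h :
  locally_constant f -> locally_constant h -> locally_constant (fun p => g (f p) (h p)).
Proof.
move=> cf ch; apply: (@lc_bind V U f (fun v p => g v (h p))) => // v.
exact: lc_comp.
Qed.

Lemma lc_fst f : locally_constant f -> locally_constant (fun p => p.1 (f p)).
Proof.
move=> cf; apply: (@lc_bind _ _ f (fun n p => p.1 n)) => // n p.
by exists n.+1 => q /(_ n (ltnSn n)) [->].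
Qed.

Lemma lc_snd f : locally_constant f -> locally_constant (fun p => p.2 (f p)).
Proof.
move=> cf; apply: (@lc_bind _ _ f (fun n p => p.2 n)) => // n p.
by exists n.+1 => q /(_ n (ltnSn n)) [_ ->].
Qed.

Lemma lc_map (I V : Type) (F : I -> cantor_baire -> V) (l : seq I) :
  (forall i, locally_constant (F i)) ->
  locally_constant (fun p => map (F ^~ p) l).
Proof.
move=> cF; elim: l => [|i l IH] /=; first exact: lc_cst.
exact: lc_comp2.
Qed.

Lemma seq_closed_lc (P : cantor_baire -> Prop) : locally_constant P -> seq_closed P.
Proof. by move=> cP p nP; have [N h] := cP p; exists N => q /h ->. Qed.

Lemma seq_closedI F G : seq_closed F -> seq_closed G -> seq_closed (F `&` G).
Proof.
move=> cF cG p /not_andP[/cF|/cG] [N h]; exists N => q /h nq []; by [].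
Qed.

Lemma seq_closed_forall I (F : I -> set cantor_baire) :
  (forall i, seq_closed (F i)) -> seq_closed [set p | forall i, F i p].
Proof. by move=> cF p /existsNP[i /cF[N h]]; exists N => q /h nq /(_ i). Qed.

Lemma prod_nat_nbhs (T : topologicalType) (f : prod_topology (fun _ : nat => T)) N :
  (forall x : T, nbhs x [set x]) ->
  nbhs f ([set g | forall k, k < N -> f k = g k] : set (prod_topology _)).
Proof.
have FF : Filter (nbhs f) by apply: nbhs_filter.
move=> dT; elim: N => [|N IH]; first exact: filterE.
have fN : nbhs f (proj N @^-1` [set f N]) by apply: proj_continuous; exact: dT.
apply: filterS (filterI IH fN) => g [fg gN] k.
by rewrite ltnS leq_eqVlt => /predU1P[->|/fg].
Qed.

Lemma nbhs_agree N (p : cantor_space * baire_space) :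
  nbhs p (agree N p).
Proof.
exists ([set x | forall k, k < N -> p.1 k = x k],
        [set x | forall k, k < N -> p.2 k = x k]).
  by split; apply: prod_nat_nbhs => x; exact: discrete_set1.
by move=> q [h1 h2] k kN; split; [apply: h1|apply: h2].
Qed.

Lemma nbhs_prod_nat (T : topologicalType) (f : prod_topology (fun _ : nat => T))
  A : nbhs f A -> exists N, forall g, (forall k, k < N -> f k = g k) -> A g.
Proof.
(* The sets containing a cylinder around [f] form a filter; its convergence to [f] is checked
   coordinate by coordinate. *)
pose G : set_system (prod_topology (fun _ : nat => T)) := [set A |
  exists N, forall g, (forall k, k < N -> f k = g k) -> A g].
have FG : Filter G.
  split=> [|P Q [N hP] [M hQ]|P Q PQ [N hP]]; first by exists 0.
    by exists (maxn N M) => g h; split; [apply: hP|apply: hQ] => k kN; apply: h;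
      rewrite leq_max kN ?orbT.
  by exists N => g /hP /PQ.
suff : G --> f by apply.
apply/cvg_sup => i U.
have /= -> := @nbhsE
  (initial_topology (fun g : prod_topology (fun _ : nat => T) => g i)) f.
case=> B [[C oC <-] Cf] BU.
by exists i.+1 => g /(_ i (ltnSn i)) E; apply: BU; rewrite /= -E.
Qed.

Lemma agree_nbhs (p : cantor_space * baire_space) A : nbhs p A ->
  exists N, forall q, agree N p q -> A q.
Proof.
move=> [[P Q] /= [/nbhs_prod_nat[N hP] /nbhs_prod_nat[M hQ]] PQA].
exists (maxn N M) => q h; apply: PQA; split=> /=; [apply: hP|apply: hQ] => k kN.
  by have [] := h k; rewrite ?leq_max ?kN.
by have [] := h k; rewrite ?leq_max ?kN ?orbT.
Qed.

Lemma seq_closedP (F : set (cantor_space * baire_space)) : closed F <-> seq_closed F.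
Proof.
split=> [cF p nFp|cF].
  apply: (@agree_nbhs p (~` F)); apply: open_nbhs_nbhs; split => //.
  exact: closed_openC.
rewrite -openC openE => p /cF[N h].
by apply: filterS (nbhs_agree N p) => q /h.
Qed.

(** * Codes of tree-valued maps *)

Definition slice (i : nat) (b : nat -> nat) (n : nat) : nat := b (pickle (i, n)).

Definition nonzero (b : nat -> nat) (n : nat) : bool := b n != 0.

Definition decode_map (b : nat -> nat) (s : seq nat) : seq nat :=
  odflt [::] (unpickle (b (pickle s))).

Lemma slice_merge (f : nat -> nat -> nat) : exists b, forall i, slice i b = f i.
Proof.
exists (fun n => if unpickle n is Some (i, m) then f i m else 0) => i.
by apply/funext => n; rewrite /slice pickleK.
Qed.

Lemma nonzero_surj (x : nat -> bool) : exists b, nonzero b = x.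
Proof. by exists x; apply/funext => n; rewrite /nonzero; case: (x n). Qed.

Lemma decode_map_surj e : exists b, decode_map b = e.
Proof.
exists (fun n => if unpickle n is Some s then pickle (e s) else 0).
by apply/funext => s; rewrite /decode_map !pickleK.
Qed.

Lemma lc_nonzero (f : cantor_baire -> nat -> nat) n :
  (forall n, locally_constant (f ^~ n)) ->
  locally_constant (fun p : cantor_baire => nonzero (f p) n).
Proof. by move=> cf; apply: (@lc_comp _ _ (fun m => m != 0)). Qed.

Definition maps (b : nat -> nat) (A B : set (seq nat)) : Prop :=
  lipschitz (decode_map b) /\ forall s, A s -> B (decode_map b s).

Lemma tree_leP A B : tree_le A B <-> exists b, maps b A B.
Proof.
split=> [[e le eAB]|[b [lb bAB]]]; last by exists (decode_map b).
by have [b be] := decode_map_surj e; exists b; rewrite /maps be.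
Qed.

(** For fixed sequences each clause inspects finitely many coordinates, so the whole is an
    intersection of clopen conditions. Comparing ranks thereby becomes a projection of a closed
    set. *)
Lemma seq_closed_maps (b : cantor_baire -> nat -> nat)
  (A B : cantor_baire -> set (seq nat)) :
  (forall n, locally_constant (b ^~ n)) ->
  (forall s, locally_constant (A ^~ s)) -> (forall s, locally_constant (B ^~ s)) ->
  seq_closed [set p | maps (b p) (A p) (B p)].
Proof.
move=> cb cA cB.
have cd s : locally_constant (fun p => decode_map (b p) s).
  exact: (@lc_comp _ _ (fun m => odflt [::] (unpickle m))).
apply: seq_closedI; first apply: seq_closedI.
- apply: seq_closed_forall => s; apply: seq_closed_lc.
  exact: (@lc_comp _ _ (fun t => size t = size s)).
- apply: seq_closed_forall => s; apply: seq_closed_forall => k; apply: seq_closed_lc.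
  exact: (@lc_comp2 _ _ _ (fun t u => t = take k u)).
- apply: seq_closed_forall => s; apply: seq_closed_lc.
  apply: (@lc_comp2 _ _ _ (fun P Q : Prop => P -> Q) (A ^~ s)) => //.
  exact: (@lc_bind _ _ (fun p => decode_map (b p) s) (fun t p => B p t)).
Qed.

(** The second clause makes the [T x] sections of a single tree of pairs of finite sequences of
    equal length, which one point of the Baire space can code. *)
Definition tree_family (T : (nat -> bool) -> set (seq nat)) : Prop :=
  (forall x, tree (T x)) /\
  forall x x' s, (forall k, k < size s -> x k = x' k) -> T x s -> T x' s.

Lemma lc_tree_family T (x : cantor_baire -> nat -> bool) s : tree_family T ->
  (forall n, locally_constant (x ^~ n)) -> locally_constant (fun p => T (x p) s).
Proof.
move=> [_ lT] cx.
have -> : (fun p => T (x p) s) =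
    (fun p => T (nth false (mkseq (x p) (size s))) s).
  apply/funext => p; apply/propext; split; apply: lT => k ks; by rewrite nth_mkseq.
apply: (@lc_comp _ _ (fun u => T (nth false u) s)).
exact: (@lc_map _ _ (fun n p => x p n)).
Qed.

(** All nonempty initial segments of [s] are tested, so every [c] whatsoever yields a tree with a
    root. *)
Definition code_tree (c : nat -> nat) (x : nat -> bool) : set (seq nat) :=
  [set s | all (fun k => c (pickle (mkseq x k.+1, take k.+1 s)) != 0)
    (iota 0 (size s))].

Lemma code_treeP c x s : code_tree c x s <->
  forall k, k < size s -> c (pickle (mkseq x k.+1, take k.+1 s)) != 0.
Proof.
split=> [/allP h k ks|h]; first by apply: h; rewrite mem_iota.
by apply/allP => k; rewrite mem_iota => /h.
Qed.

Lemma code_tree_tree c x : tree (code_tree c x).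
Proof.
split=> // s k /code_treeP h; apply/code_treeP => j.
rewrite size_take_min leq_min => /andP[jk js].
by rewrite take_takel //; apply: h.
Qed.

Lemma lc_code_tree (c : cantor_baire -> nat -> nat)
  (x : cantor_baire -> nat -> bool) s :
  (forall n, locally_constant (c ^~ n)) -> (forall n, locally_constant (x ^~ n)) ->
  locally_constant (fun p => code_tree (c p) (x p) s).
Proof.
move=> cc cx.
pose F k p := c p (pickle (mkseq (x p) k.+1, take k.+1 s)) != 0.
have -> : (fun p => code_tree (c p) (x p) s) =
    (fun p => all id (map (F ^~ p) (iota 0 (size s))) : Prop).
  by apply/funext => p; rewrite all_map.
apply: (@lc_comp _ _ (fun l => all id l : Prop)); apply: lc_map => k.
apply: (@lc_comp _ _ (fun m => m != 0)).
apply: (@lc_bind _ _ (fun p => mkseq (x p) k.+1)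
  (fun u p => c p (pickle (u, take k.+1 s)))) => //.
exact: (@lc_map _ _ (fun n p => x p n)).
Qed.

Lemma code_tree_surj T : tree_family T -> exists c, forall x, code_tree c x = T x.
Proof.
move=> [tT lT].
exists (fun n =>
  if unpickle n is Some (u, s) then `[< T (nth false u) s >] : nat else 0).
move=> x; apply/seteqP; split=> s.
  move=> /code_treeP; case: (posnP (size s)) => [/size0nil -> _|s0 h].
    by have [] := tT x.
  have := h (size s).-1; rewrite pickleK prednK // leqnn take_size => /(_ isT).
  case: asboolP => // Ts _; apply: lT Ts => k ks; by rewrite nth_mkseq.
move=> Ts; apply/code_treeP => k ks; rewrite pickleK; case: asboolP => // -[].
apply: (lT x); last by have [_] := tT x; apply.
move=> j; rewrite size_take_min leq_min => /andP[jk _].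
by rewrite nth_mkseq.
Qed.

(** * Combination modulo finite sets and badness *)

Definition combines (w x y : nat -> bool) : Prop :=
  exists N, forall n, N <= n -> w n -> x n || y n.

(* Write [rk x] for the rank of [T x]. When [T x] is well founded, [x] is good iff
   every initial segment [{y | rk y <= a}] with [a <= rk x] is closed under
   [combines]. The comparisons being expressed by maps between trees, badness is
   a [Sigma^1_1] condition, and it covers the case where [T x] is ill-founded. *)
Definition bad (T : (nat -> bool) -> set (seq nat)) (x : nat -> bool) : Prop :=
  exists y y' w, [/\ combines w y y', tree_le (T y') (T y), tree_le (T y) (T x) &
    tree_lt (T y) (T w)].

Lemma combinesl (w x y : nat -> bool) : (forall n, w n -> x n) -> combines w x y.
Proof. by move=> h; exists 0 => n _ /h ->. Qed.

Lemma combinesC (w x y : nat -> bool) : combines w x y -> combines w y x.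
Proof. by move=> [N h]; exists N => n Nn wn; rewrite orbC; apply: h. Qed.

Lemma bad_illfounded T x : illfounded (T x) -> bad T x.
Proof.
move=> iT; exists x, x, x; split; [exact: combinesl|exact: tree_le_refl..|].
exact: illfounded_lt.
Qed.

(** Let [x] have the larger rank. If [w] ranks at most as high as [x], witnesses of [bad T w] also
    show [bad T x]; otherwise [x], [x'] and [w] themselves do. *)
Lemma good_combines T w x x' : (forall x, tree (T x)) -> combines w x x' ->
  ~ bad T x -> ~ bad T x' -> ~ bad T w.
Proof.
move=> tT; wlog le : x x' / tree_le (T x') (T x).
  move=> hw cwx gx gx'; have [le|/tree_ltW le] := tree_le_or_lt (tT x') (tT x).
    exact: (hw x x').
  by apply: (hw x' x) => //; [exact: le|exact: combinesC].
move=> cwx gx gx' [y [y' [v [cv y'y yw yv]]]].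
have [wx|xw] := tree_le_or_lt (tT w) (tT x); apply: gx.
  by exists y, y', v; split => //; apply: tree_le_trans wx.
by exists x, x', w; split => //; apply: tree_le_refl.
Qed.

(** * Every ideal presented by trees is coded *)

Definition approximations (F : set cantor_baire) (y : nat -> bool) : set (seq nat) :=
  [set s | exists2 p, F p & agree (size s) (y, nth 0 s) p].

Lemma agree_take k s y p : agree (size s) (y, nth 0 s) p ->
  agree (size (take k s)) (y, nth 0 (take k s)) p.
Proof.
rewrite size_take_min => h j /=; rewrite leq_min => /andP[jk js].
by rewrite nth_take //; apply: h.
Qed.

Lemma agree_fst y y' s p : (forall k, k < size s -> y k = y' k) ->
  agree (size s) (y, nth 0 s) p -> agree (size s) (y', nth 0 s) p.
Proof. by move=> yy' h k ks /=; rewrite -yy' //; apply: h. Qed.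

Lemma approximations_family F : F !=set0 -> tree_family (approximations F).
Proof.
move=> [p0 Fp0]; split=> [y|y y' s yy' [p Fp h]]; last first.
  by exists p => //; apply: agree_fst h.
split=> [|s k [p Fp h]]; first by exists p0.
by exists p => //; apply: agree_take.
Qed.

Lemma approximations_illfounded F y : seq_closed F ->
  illfounded (approximations F y) <-> exists z, F (y, z).
Proof.
move=> cF; split=> [[z h]|[z Fz]]; exists z; last first.
  by move=> k; exists (y, z) => // j; rewrite size_mkseq => jk; rewrite /= nth_mkseq.
apply: contrapT => /cF[N hN]; have [p Fp hp] := h N.
apply: (hN p) => // j jN; have := hp j; rewrite size_mkseq /= nth_mkseq //.
by apply.
Qed.

(** One entry of a node packs one entry each of [w], of the witnesses [q] and of a branch of the
    tree at [w], so that passing from [T w] to the new tree preserves length. *)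
Definition decode_triple (n : nat) : bool * nat * nat :=
  odflt (false, 0, 0) (unpickle n).

Definition triple_set (z : nat -> nat) (n : nat) : bool := (decode_triple (z n)).1.1.
Definition triple_witness (z : nat -> nat) (n : nat) : nat := (decode_triple (z n)).1.2.
Definition triple_branch (z : nat -> nat) (n : nat) : nat := (decode_triple (z n)).2.

Definition encode_triple (w : nat -> bool) (q b : nat -> nat) (n : nat) : nat :=
  pickle (w n, q n, b n).

Lemma encode_tripleK w q b : [/\ triple_set (encode_triple w q b) = w,
  triple_witness (encode_triple w q b) = q & triple_branch (encode_triple w q b) = b].
Proof.
by split; apply/funext => n; rewrite /triple_set /triple_witness /triple_branch
  /decode_triple /encode_triple pickleK.
Qed.

(** * One closure step on a family of trees *)

Section closure_step.
Variable R : (nat -> bool) -> set (seq nat).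
Hypothesis R_family : tree_family R.

(* The slices of [q] are a code of [y'], the bound in [combines w y y'] (as the
   value at 0) and a code of the map [R y' -> R y]. *)
Definition step_closed : set cantor_baire := [set p |
  let w := triple_set p.2 in let q := triple_witness p.2 in
  let y' := nonzero (slice 0 q) in
  (forall n, slice 1 q 0 <= n -> w n -> p.1 n || y' n) /\
  maps (slice 2 q) (R y') (R p.1)].

(** The point [p] agrees with [y] and [s] only up to the length of [s], which keeps nodes dependent
    on finitely many values of [y]. *)
Definition closure_step (T : (nat -> bool) -> set (seq nat)) (y : nat -> bool) :
    set (seq nat) :=
  [set s | exists p, [/\ step_closed p, agree (size s) (y, nth 0 s) p &
    T (triple_set p.2) (mkseq (triple_branch p.2) (size s))]].

Lemma step_closed_closed : seq_closed step_closed.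
Proof.
have cw n : locally_constant (fun p => triple_set p.2 n).
  apply: (@lc_comp _ _ (fun m => (decode_triple m).1.1)); apply: lc_snd; exact: lc_cst.
have cq n : locally_constant (fun p => triple_witness p.2 n).
  apply: (@lc_comp _ _ (fun m => (decode_triple m).1.2)); apply: lc_snd; exact: lc_cst.
have cy' n : locally_constant (fun p => nonzero (slice 0 (triple_witness p.2)) n).
  by apply: (@lc_nonzero (fun p => slice 0 (triple_witness p.2))) => m; apply: cq.
apply: seq_closedI.
  apply: seq_closed_forall => n; apply: seq_closed_lc.
  apply: (@lc_comp2 _ _ _ (fun P Q : Prop => P -> Q)).
    by apply: (@lc_comp _ _ (fun m => m <= n : Prop)); apply: cq.
  apply: (@lc_comp2 _ _ _ (fun (P : bool) (Q : Prop) => P -> Q)) => //.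
  apply: (@lc_comp2 _ _ _ (fun b b' : bool => b || b' : Prop)) => //.
  by apply: lc_fst; apply: lc_cst.
apply: seq_closed_maps => [n|s|s]; first exact: cq.
  exact: lc_tree_family.
by apply: lc_tree_family => // n; apply: lc_fst; apply: lc_cst.
Qed.

Lemma step_closed_ex w y y' : combines w y y' -> tree_le (R y') (R y) ->
  exists q, forall b, step_closed (y, encode_triple w q b).
Proof.
move=> [N hN] /tree_leP[e eP]; have [a ay'] := nonzero_surj y'.
have [q qP] := slice_merge (fun i => match i with 0 => a | 1 => fun=> N | _ => e end).
exists q => b; rewrite /step_closed /=.
have [-> -> _] := encode_tripleK w q b.
by rewrite !qP ay'.
Qed.

Lemma step_closedP p : step_closed p -> exists y',
  combines (triple_set p.2) p.1 y' /\ tree_le (R y') (R p.1).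
Proof.
move=> [h1 h2]; exists (nonzero (slice 0 (triple_witness p.2))); split.
  by exists (slice 1 (triple_witness p.2) 0).
by apply/tree_leP; exists (slice 2 (triple_witness p.2)).
Qed.

Section family.
Variable T : (nat -> bool) -> set (seq nat).
Hypothesis T_family : tree_family T.

(** With [w] and [q] fixed, each node of [T w] is packed with initial segments of both. So the new
    rank at [y] bounds the old ranks at all such [w]. *)
Lemma closure_step_le w y y' : combines w y y' -> tree_le (R y') (R y) ->
  tree_le (T w) (closure_step T y).
Proof.
move=> cw le; have [q qP] := step_closed_ex cw le.
pose z s := encode_triple w q (nth 0 s).
exists (fun s => mkseq (z s) (size s)).
  split=> [s|s k]; first by rewrite size_mkseq.
  rewrite take_mkseq size_take_min; apply/eq_in_map => n.
  by rewrite mem_iota leq_min /= => /andP[nk _]; rewrite /z /encode_triple nth_take.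
move=> s Ts; exists (y, z s); split; first exact: (qP (nth 0 s)).
  by move=> k; rewrite size_mkseq => ks /=; rewrite nth_mkseq.
rewrite size_mkseq /=.
have [-> _ ->] := encode_tripleK w q (nth 0 s).
by rewrite mkseq_nth.
Qed.

Lemma closure_step_family : tree_family (closure_step T).
Proof.
split=> [y|y y' s yy' [p [Cp h Tp]]]; last by exists p; split=> //; apply: agree_fst h.
split=> [|s k [p [Cp h Tp]]].
  (* The root requires some triple to exist: [w = y' = y] with the identity map. *)
  have yy : combines y y y by exact: combinesl.
  have [q qP] := step_closed_ex yy (tree_le_refl (R y)).
  exists (y, encode_triple y q (fun=> 0)).
  by split=> [||]; [exact: qP| |exact: (T_family.1 _).1].
exists p; split => //; first exact: agree_take.
by rewrite size_take_min -take_mkseq; apply: (T_family.1 _).2.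
Qed.

Lemma closure_step_illfounded y : illfounded (closure_step T y) ->
  exists w y', [/\ combines w y y', tree_le (R y') (R y) & illfounded (T w)].
Proof.
move=> [z h].
(* Points of [step_closed] come arbitrarily close to [(y, z)], so closedness applies. *)
have Cz : step_closed (y, z).
  apply: contrapT => /step_closed_closed[N hN]; have [p [Cp hp _]] := h N.
  apply: (hN p) => // j jN; have := hp j; rewrite size_mkseq /= nth_mkseq //.
  by apply.
have [y' /= [cw le]] := step_closedP Cz.
exists (triple_set z), y'; split => //; exists (triple_branch z) => k.
have [p [_ hp]] := h k; rewrite size_mkseq in hp *.
have zp j : j < k -> p.2 j = z j.
  by move=> jk; have [_ <-] := hp j jk; rewrite /= nth_mkseq.
have -> : mkseq (triple_branch p.2) k = mkseq (triple_branch z) k.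
  by apply/eq_in_map => j; rewrite mem_iota => jk; rewrite /triple_branch zp.
apply: T_family.2; rewrite size_mkseq => j jk.
by rewrite /triple_set zp.
Qed.

End family.
End closure_step.

(** [T n y] sits above the child [n] of the root, so any tree mapping into it is strictly below the
    join. *)
Definition join_family (T : nat -> (nat -> bool) -> set (seq nat)) (y : nat -> bool) :
    set (seq nat) :=
  [set s | if s is n :: s' then T n y s' else True].

Lemma join_familyP T :
  (forall n, tree_family (T n)) -> tree_family (join_family T).
Proof.
move=> TT; split=> [y|y y' [|n s] // yy']; last first.
  by apply: (TT n).2 => k ks; apply: yy'; rewrite ltnS ltnW.
by split=> // -[|n s] [|k] //=; apply: ((TT n).1 y).2.
Qed.

Lemma join_family_illfounded T y : illfounded (join_family T y) ->
  exists n, illfounded (T n y).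
Proof.
move=> [b h]; exists (b 0), (b \o S) => k.
by have := h k.+1; rewrite /mkseq /= (iotaDl 1 0) -map_comp.
Qed.

Section ideal_code.
Variable (G : set (nat -> bool)) (R : (nat -> bool) -> set (seq nat)).
Hypothesis R_family : tree_family R.
Hypothesis R_illfounded : forall x, illfounded (R x) <-> ~ G x.
Hypothesis G_combines : forall w x y, combines w x y -> G x -> G y -> G w.

Let T n := iter n (closure_step R) R.
Let S := join_family T.

Let T_family n : tree_family (T n).
Proof. by elim: n => // n IH; apply: closure_step_family. Qed.

Let S_family : tree_family S. Proof. exact: join_familyP. Qed.

(** If [x] is in [G] and [R y'] maps to the well-founded [R x], then [y'] is in [G], hence so is
    [w], and the induction hypothesis applies to [w]. *)
Let T_illfounded n x : illfounded (T n x) -> ~ G x.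
Proof.
elim: n x => [x /R_illfounded //|n IH x].
move=> /(closure_step_illfounded R_family (T_family n))[w [y' [cw le /IH nGw]]] Gx.
apply: nGw; apply: (G_combines cw Gx); apply: contrapT => /R_illfounded iy'.
by apply: (R_illfounded x).1 Gx; apply: illfounded_le iy'.
Qed.

Let S_illfounded x : illfounded (S x) -> ~ G x.
Proof. by move=> /join_family_illfounded[n /T_illfounded]. Qed.

Let illfounded_S x : ~ G x -> illfounded (S x).
Proof.
(* The branch passes through the child 0, above which lies [T 0 = R]. *)
move=> /R_illfounded[b hb]; exists (fun n => if n is m.+1 then b m else 0) => -[|k] //.
by rewrite /mkseq /= (iotaDl 1 0) -map_comp; apply: hb.
Qed.

Let G_le x y : G y -> tree_le (S x) (S y) -> G x.
Proof.
move=> Gy le; apply: contrapT => /illfounded_S ix.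
by apply: S_illfounded Gy; apply: illfounded_le ix.
Qed.

(** Badness at a point of [G] would map [S y] into some [T n w]. If [R y'] maps to [R y], then
    [T n w] maps into [T n.+1 y], a proper subtree of [S y], contradicting well-foundedness;
    otherwise [y] and [y'] exchange roles. *)
Lemma good_family_ex : exists2 S, tree_family S & forall x, bad S x <-> ~ G x.
Proof.
exists S => // x; split=> [|/illfounded_S]; last exact: bad_illfounded.
move=> [y [y' [w [cw y'y yx [n yw]]]]] Gx.
have Gy := G_le Gx yx; have Gy' := G_le Gy y'y.
have irr z : G z -> tree_le (S z) (T n.+1 z) -> False.
  move=> Gz le; apply: S_illfounded Gz; apply: tree_lt_irrefl; first exact: S_family.1.
  by exists n.+1.
have [le|/tree_ltW le] := tree_le_or_lt (R_family.1 y') (R_family.1 y).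
  by apply: (irr y Gy); apply: tree_le_trans yw _; apply: closure_step_le le.
apply: (irr y' Gy'); apply: tree_le_trans y'y _; apply: tree_le_trans yw _.
apply: (@closure_step_le R (T n) w y' y); first exact: combinesC.
by apply: le; apply: R_family.1.
Qed.

End ideal_code.

(** * The universal ideal *)

Definition unbounded (x : nat -> bool) : Prop := forall n, exists2 m, n <= m & x m.

Definition trace (X : set nat) (c : nat -> nat) (n : nat) : bool :=
  `[< X (pickle (mkseq c n)) >].

Definition universal_ideal : set (set nat) :=
  [set X | forall c, unbounded (trace X c) -> ~ bad (code_tree c) (trace X c)].

Lemma unboundedPn x : ~ unbounded x -> exists N, forall n, N <= n -> ~~ x n.
Proof.
move=> /existsNP[N h]; exists N => n Nn; apply/negP => xn; apply: h; by exists n.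
Qed.

Lemma unboundedP x : unbounded x <-> infinite_set [set n | x n].
Proof.
split=> [ux /finite_seqP[s xs]|ix n].
  have [m sm xm] := ux (\max_(i <- s) i).+1.
  have : (m <= \max_(i <- s) i)%N.
    apply: leq_bigmax_seq => //.
    by have : [set` s] m by rewrite -xs.
  by rewrite leqNgt sm.
apply: contrapT => /forall2NP h; apply: ix.
apply: (sub_finite_set _ (finite_II n)) => m xm /=.
by have [/negP|//] := h m; rewrite -ltnNge.
Qed.

Lemma pickle_mkseq_inj (c : nat -> nat) : injective (fun n => pickle (mkseq c n)).
Proof.
by move=> m n /(pcan_inj pickleK)/(congr1 size); rewrite !size_mkseq.
Qed.

Definition code_length (n : nat) : nat :=
  size (odflt [::] (@unpickle (seq nat) n)).

Lemma code_length_mkseq (c : nat -> nat) n : code_length (pickle (mkseq c n)) = n.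
Proof. by rewrite /code_length pickleK /= size_mkseq. Qed.

Lemma universal_ideal_ideal : ideal universal_ideal.
Proof.
split=> [X Y JX JY c|X Y YX JX c uY].
  set x := trace X c; set y := trace Y c.
  have xyP n : trace (X `|` Y) c n = x n || y n by exact: asbool_or.
  move=> uxy bxy.
  have ct := code_tree_tree c.
  (* A bounded trace is absorbed by the finite error in [combines]. *)
  have [ux|/unboundedPn[N hN]] := pselect (unbounded x);
    have [uy|/unboundedPn[M hM]] := pselect (unbounded y).
  - apply: (good_combines (x := x) (x' := y) ct _ (JX c ux) (JY c uy) bxy).
    by exists 0 => n _; rewrite xyP.
  - apply: (good_combines (x := x) (x' := x) ct _ (JX c ux) (JX c ux) bxy).
    by exists M => n /hM /negPf yn; rewrite xyP yn orbF => ->.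
  - apply: (good_combines (x := y) (x' := y) ct _ (JY c uy) (JY c uy) bxy).
    by exists N => n /hN /negPf xn; rewrite xyP xn => /= ->.
  - have [n] := uxy (maxn N M); rewrite geq_max => /andP[/hN /negPf xn /hM /negPf yn].
    by rewrite xyP xn yn.
have YXc n : trace Y c n -> trace X c n by move/asboolP/YX => ?; apply/asboolP.
have uX : unbounded (trace X c) by move=> n; have [m nm /YXc] := uY n; exists m.
apply: (good_combines (code_tree_tree c) _ (JX c uX) (JX c uX)).
exact: combinesl.
Qed.

Lemma finite_traces_universal_ideal X : (forall c, finite_set [set n | trace X c n]) ->
  universal_ideal X.
Proof. by move=> h c /unboundedP; have := h c. Qed.

Lemma finite_in_universal_ideal X : finite_set X -> universal_ideal X.
Proof.
move=> fX; apply: finite_traces_universal_ideal => c.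
have -> : [set n | trace X c n] = (fun n => pickle (mkseq c n)) @^-1` X.
  by apply/seteqP; split=> n /= /asboolP.
by apply: finite_preimage => // m n _ _; apply: pickle_mkseq_inj.
Qed.

Lemma universal_ideal_proper : proper_ideal universal_ideal.
Proof.
split; [exact: universal_ideal_ideal| |exact: finite_in_universal_ideal].
move=> JT; have : universal_ideal setT by rewrite JT.
(* The constant code 1 accepts every node, so all its trees are ill-founded. *)
move=> /(_ (fun=> 1)); apply.
  by move=> n; exists n => //; apply/asboolP.
by apply: bad_illfounded; exists id => k; apply/code_treeP.
Qed.

(** The sequences of length one meet each branch once, so every set of them is in the ideal;
    Cantor's diagonal runs over these sets. *)
Lemma universal_ideal_uncountable : ~ countable (char_family universal_ideal).
Proof.
move=> /pfcard_geP[E|[f]].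
  have : universal_ideal [set n : nat | false].
    by apply: finite_in_universal_ideal; apply: (sub_finite_set _ (finite_set0 _)).
  by move: E => /seteqP[/(_ (fun=> false))].
pose d n := if unpickle n is Some [:: k] then ~~ f k n else false.
have : char_family universal_ideal d.
  apply: finite_traces_universal_ideal => c.
  apply: (sub_finite_set _ (finite_set1 1)) => n /= /asboolP /=.
  rewrite /d pickleK.
  by have := size_mkseq c n; case: mkseq => // a [].
move=> Jd; have [k _ fk] := 'surj_f Jd.
have := congr1 (fun g : nat -> bool => g (pickle [:: k])) fk.
have negb_neq (b : bool) : b = ~~ b -> False by case: b.
by rewrite /d pickleK; apply: negb_neq.
Qed.

(** In the complement, the branch [c] and all witnesses are quantified existentially, so they merge
    into one point of the Baire space. *)
Lemma universal_ideal_Pi11 : Pi11 (char_family universal_ideal).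
Proof.
pose x (p : cantor_baire) n := p.1 (pickle (mkseq (slice 0 p.2) n)).
(* The slices of [p.2] are [c], [y], [y'], [w], a witness of unboundedness, the bound
   in [combines w y y'], the three maps and the root of the last one. *)
pose F : set cantor_baire := [set p |
  let c := slice 0 p.2 in let y := nonzero (slice 1 p.2) in
  let y' := nonzero (slice 2 p.2) in let w := nonzero (slice 3 p.2) in
  [/\ forall n, n <= slice 4 p.2 n /\ x p (slice 4 p.2 n),
   forall n, slice 5 p.2 0 <= n -> w n -> y n || y' n,
   maps (slice 6 p.2) (code_tree c y') (code_tree c y),
   maps (slice 7 p.2) (code_tree c y) (code_tree c (x p)) &
   maps (slice 8 p.2) (code_tree c y) [set s | code_tree c w (slice 9 p.2 0 :: s)]]].
have cs i n : locally_constant (fun p => slice i p.2 n).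
  by apply: lc_snd; apply: lc_cst.
have cnz i n : locally_constant (fun p => nonzero (slice i p.2) n).
  by apply: (@lc_nonzero (fun p => slice i p.2)) => m; apply: cs.
have cx n : locally_constant (x ^~ n).
  apply: lc_fst; apply: (@lc_comp _ _ pickle).
  by apply: (@lc_map _ _ (fun k p => slice 0 p.2 k)) => k; apply: cs.
have cF : seq_closed F.
  have -> : F = [set p | forall n, n <= slice 4 p.2 n /\ x p (slice 4 p.2 n)] `&`
    [set p | forall n, slice 5 p.2 0 <= n -> nonzero (slice 3 p.2) n ->
      nonzero (slice 1 p.2) n || nonzero (slice 2 p.2) n] `&`
    [set p | maps (slice 6 p.2) (code_tree (slice 0 p.2) (nonzero (slice 2 p.2)))
      (code_tree (slice 0 p.2) (nonzero (slice 1 p.2)))] `&`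
    [set p | maps (slice 7 p.2) (code_tree (slice 0 p.2) (nonzero (slice 1 p.2)))
      (code_tree (slice 0 p.2) (x p))] `&`
    [set p | maps (slice 8 p.2) (code_tree (slice 0 p.2) (nonzero (slice 1 p.2)))
      [set s | code_tree (slice 0 p.2) (nonzero (slice 3 p.2)) (slice 9 p.2 0 :: s)]].
    by apply/seteqP; split=> p; [case|move=> [[[[]]]]].
  have cct f s : (forall n, locally_constant (f ^~ n)) ->
      locally_constant (fun p => code_tree (slice 0 p.2) (f p) s).
    by move=> cf; apply: lc_code_tree => // n; apply: cs.
  apply: seq_closedI; first apply: seq_closedI; first apply: seq_closedI;
    first apply: seq_closedI.
  - apply: seq_closed_forall => n; apply: seq_closedI; apply: seq_closed_lc.
      by apply: (@lc_comp _ _ (fun m => n <= m : Prop)); apply: cs.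
    apply: (@lc_comp _ _ (fun b : bool => b : Prop)).
    exact: (@lc_bind _ _ (fun p => slice 4 p.2 n) (fun m p => x p m)).
  - apply: seq_closed_forall => n; apply: seq_closed_lc.
    apply: (@lc_comp2 _ _ _ (fun P Q : Prop => P -> Q)).
      by apply: (@lc_comp _ _ (fun m => m <= n : Prop)); apply: cs.
    apply: (@lc_comp2 _ _ _ (fun (P : bool) (Q : Prop) => P -> Q)) => //.
    exact: (@lc_comp2 _ _ _ (fun b b' : bool => b || b' : Prop)).
  - by apply: seq_closed_maps => [n|s|s]; [apply: cs|apply: cct|apply: cct].
  - by apply: seq_closed_maps => [n|s|s]; [apply: cs|apply: cct|apply: cct].
  - apply: seq_closed_maps => [n|s|s]; [exact: cs|exact: cct|].
    apply: (@lc_bind _ _ (fun p => slice 9 p.2 0) (fun m p =>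
      code_tree (slice 0 p.2) (nonzero (slice 3 p.2)) (m :: s))) => // m.
    exact: cct.
exists F; first exact/seq_closedP.
have trE (X : cantor_space) b :
    trace [set n | X n] (slice 0 b) = x (X, b).
  by apply/funext => n; rewrite /trace asboolb.
apply/seteqP; split=> [X|_ [[X b] [h1 h2 h3 h4 h5] <-]]; last first.
  rewrite /= => /(_ (slice 0 b)); rewrite trE; apply.
    by move=> n; have [] := h1 n; exists (slice 4 b n).
  exists (nonzero (slice 1 b)), (nonzero (slice 2 b)), (nonzero (slice 3 b)); split.
  - by exists (slice 5 b 0).
  - by apply/tree_leP; exists (slice 6 b).
  - by apply/tree_leP; exists (slice 7 b).
  - by exists (slice 9 b 0); apply/tree_leP; exists (slice 8 b).
rewrite /= => /existsNP[c /not_implyP[u /contrapT]].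
move=> [y [y' [w [[N hN] /tree_leP[e1 h1] /tree_leP[e2 h2] [m /tree_leP[e3 h3]]]]]].
have [a aE] := nonzero_surj y; have [a' a'E] := nonzero_surj y'.
have [aw awE] := nonzero_surj w.
have /choice[h hP] n : exists k, n <= k /\ trace [set n | X n] c k.
  by have [k] := u n; exists k.
(* The list ends with slice 8; slice 9, the root [m], is the default of [nth]. *)
have [b bE] := slice_merge (fun i => nth (fun=> m)
  [:: c; a; a'; aw; h; (fun=> N); e1; e2; e3] i).
exists (X, b) => //; rewrite /F /= -trE !bE /= aE a'E awE.
by split=> // n; have [nh /asboolP] := hP n; split.
Qed.

(** Sets are copied onto the branch [c] coding [I], with the length of a node as reducing function.
    Any other branch meets the copy in a bounded set, so only the condition at [c] matters. *)
Lemma universal_ideal_complete I : proper_uncountable_Pi11_ideal I ->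
  wRK_le I universal_ideal.
Proof.
move=> [[[IU IS] IT Ifin] _ [F /seq_closedP cF FE]].
pose G : set (nat -> bool) := [set x | I [set n | x n]].
have FP x : (exists z, F (x, z)) <-> ~ G x.
  have -> : (~ G x) = (~` char_family I) x by [].
  rewrite FE; split=> [[z Fz]|[[x' z] Fz <-]]; last by exists z.
  by exists (x, z).
(* Properness of [I] makes [F] nonempty, which gives the approximation trees their root. *)
have F0 : F !=set0.
  have : ~ G (fun=> true).
    move=> IT'; apply: IT; apply/seteqP; split=> // X _; apply: IS IT'.
    by move=> n _.
  by move=> /FP[z Fz]; exists ((fun=> true), z).
have Gc w x y : combines w x y -> G x -> G y -> G w.
  move=> [N h] Gx Gy; apply: (IS (([set n | x n] `|` [set n | y n]) `|` `I_N)).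
    move=> n /= wn; have [Nn|nN] := leqP N n; last by right.
    by left; have /orP[] := h n Nn wn; [left|right].
  by apply: (IU); [exact: IU|apply: Ifin; exact: finite_II].
have [S fS SG] := good_family_ex (G := G) (approximations_family F0)
  (fun x => iff_trans (approximations_illfounded x cF) (FP x)) Gc.
have [c cS] := code_tree_surj fS.
have cE : code_tree c = S by apply/funext.
exists (range (fun n => pickle (mkseq c n))); split.
  move=> fr; apply: infinite_nat; apply: sub_finite_set (finite_preimage _ fr).
    by move=> n _; exists n.
  by move=> m n _ _; apply: pickle_mkseq_inj.
exists code_length => x.
set Y := _ `&` _.
pose bx n := `[< x n >].
have GI : G bx <-> I x.
  by rewrite /G /= (_ : [set n | bx n] = x) //; apply/seteqP; split=> n /asboolP.
have trY c' n : trace Y c' n -> bx n /\ mkseq c' n = mkseq c n.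
  move=> /asboolP[[m _ /(pcan_inj pickleK) E]].
  rewrite /preimage /mkset code_length_mkseq => xn; split; first exact/asboolP.
  by have := congr1 size E; rewrite !size_mkseq => mn; rewrite -E mn.
have trc : trace Y c = bx.
  apply/funext => n; apply/idP/idP => [/trY[]//|/asboolP xn].
  by apply/asboolP; split; [exists n|rewrite /preimage /mkset code_length_mkseq].
split=> [/GI Gx c' u|JY].
  have -> : c' = c.
    apply/funext => n; have [m nm /trY[_ E]] := u n.+1.
    by have := congr1 (nth 0 ^~ n) E; rewrite !nth_mkseq.
  by rewrite trc cE => /SG.
(* The ideal says nothing about a bounded trace, but then [x] is finite and lies in [I] anyway. *)
apply/GI; have [ux|nux] := pselect (unbounded bx).
  by apply: contrapT => /SG; have := JY c; rewrite trc cE; apply.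
apply: Ifin; apply: contrapT => /unboundedP.
exact: nux.
Qed.

Theorem theorem1p7 :
  exists J : set (set nat), wRK_complete proper_uncountable_Pi11_ideal J.
Proof.
exists universal_ideal; split; last exact: universal_ideal_complete.
split; [exact: universal_ideal_proper|exact: universal_ideal_uncountable|].
exact: universal_ideal_Pi11.
Qed.
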